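(* Let $p,q,s\in[1,\infty)$ and $\alpha\in\mathbb{R}$ be constants. Suppose that for some value $m\ge\max(p,q,s)$ $$|V[\xi]|_{m,\Omega,\mathbf{P};\ p,T;\ q,[-1,1];\ s,T,\nu}<\infty .$$ Then $$\mathbf{P}\left(\xi(\cdot)\in B^{o,p,q}_{\alpha,s}\right)=1,$$ and moreover $$\Big|\ \|\xi\|B^{o,p,q}_{\alpha,s}\ \Big|_{m,\Omega,\mathbf{P}}\ \le\ |V[\xi]|_{m,\Omega,\mathbf{P};\ p,T;\ q,[-1,1];\ s,T,\nu}.$$
   Context: $T=[0,1]$. $\xi=\xi(t)=\xi(t,\omega)$, $t\in T$, is a real-valued bi-measurable random process on a probability space $(\Omega,F,\mathbf{P})$. Every function $f:T\to\mathbb{R}$ (in particular every trajectory of $\xi$) is extended to $\mathbb{R}$ by $f(t)=0$ for $t\notin T$. For a function $f$ put $S_h[f](t)=S[f](t,h)=f(t+h)-f(t)$, $t\in T$, $h\in[-1,1]$, and $|f|_{p}=|f|_{p,T}=\left(\int_0^1|f(t)|^p\,dt\right)^{1/p}$. For $\delta\in[0,1]$ let $\Delta_q[f,\delta]_p=\left[\int_{-\delta}^{\delta}|S_h[f]|_{p,T}^q\,dh\right]^{1/q}$ and $$\|f\|B^{o,p,q}_{\alpha,s}=\left\{\int_0^1\left[\delta^{-\alpha}\Delta_q[f,\delta]_p\right]^s\frac{d\delta}{\delta}\right\}^{1/s};$$ $B^{o,p,q}_{\alpha,s}$ is the space of measurable $f$ for which this quantity is finite. For a random variable $\eta$, $|\eta|_{m,\Omega,\mathbf{P}}=(\mathbf{E}|\eta|^m)^{1/m}$.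 Put $V[\xi](t,z,\delta)=\xi(t+z\delta)-\xi(t)$ for $t\in T$, $z\in[-1,1]$, $\delta\in T$. Let $\nu$ be the measure on $T$ with $\nu(d\delta)=\delta^{\gamma}\,d\delta$, $\gamma=\frac{s}{q}-\alpha s-1$. The mixed norm is taken from the inside out (first $\Omega$, then $t$, then $z$, then $\delta$): $$|V[\xi]|_{m,\Omega,\mathbf{P};\ p,T;\ q,[-1,1];\ s,T,\nu}=\left(\int_0^1\nu(d\delta)\left(\int_{-1}^1dz\left(\int_0^1dt\,\big(\mathbf{E}|V[\xi](t,z,\delta)|^m\big)^{p/m}\right)^{q/p}\right)^{s/q}\right)^{1/s}.$$ *)

(* Defs.v *)
From HB Require Import structures.
From mathcomp Require Import all_boot all_order all_algebra.
From mathcomp Require Import all_classical all_reals all_analysis.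
Set Implicit Arguments.
Unset Strict Implicit.
Unset Printing Implicit Defensive.
Import Order.TTheory GRing.Theory Num.Theory numFieldNormedType.Exports.
Local Open Scope classical_set_scope.
Local Open Scope ring_scope.
Local Open Scope ereal_scope.

Section besov.
Context {R : realType}.
Local Notation leb := (@lebesgue_measure R).

(* A function on [0, 1] is encoded as a total function on R.  Its values outside
   [0, 1] are never used: it is first replaced there by 0. *)
Definition zero_ext (f : R -> R) : R -> R := patch (fun=> 0%R) `[0%R, 1%R] f.

Definition shift_diff (f : R -> R) (h t : R) : R :=
  (zero_ext f (t + h) - zero_ext f t)%R.

Definition LpT_norm (p : R) (f : R -> R) : \bar R :=
  (\int[leb]_(t in `[0%R, 1%R]) ((`|f t| `^ p)%R)%:E) `^ p^-1.

Definition modulus (p q : R) (f : R -> R) (delta : R) : \bar R :=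
  (\int[leb]_(h in `[(- delta)%R, delta])
     (LpT_norm p (shift_diff f h) `^ q)) `^ q^-1.

(* At the null point [delta = 0] the integrand takes the junk value of the
   library ([0^-1 = 0]), which does not affect the integral. *)
Definition besov_norm (p q alpha s : R) (f : R -> R) : \bar R :=
  (\int[leb]_(delta in `[0%R, 1%R])
     (((delta `^ (- alpha))%R%:E * modulus p q f delta) `^ s
      * (delta^-1)%R%:E)) `^ s^-1.

Definition besov_space (p q alpha s : R) : set (R -> R) :=
  [set f | measurable_fun (`[0%R, 1%R] : set R) f
           /\ besov_norm p q alpha s f < +oo].

Definition nu_exponent (q alpha s : R) : R := (s / q - alpha * s - 1)%R.

Context {d : measure_display} {Omega : measurableType d}.

(* Joint measurability on [0, 1] * Omega, for the product of the Borel
   sigma-algebra and the one of Omega. *)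
Definition bimeasurable (xi : R -> Omega -> R) : Prop :=
  measurable_fun ((`[0%R, 1%R] `*` setT) : set (measurableTypeR R * Omega))
    (fun x : measurableTypeR R * Omega => xi x.1 x.2).

Definition Vdiff (xi : R -> Omega -> R) (t z delta : R) (w : Omega) : R :=
  (zero_ext (xi ^~ w) (t + z * delta) - zero_ext (xi ^~ w) t)%R.

(* The outermost integral is with respect to nu(d delta) = delta ^ gamma d delta,
   gamma = s / q - alpha s - 1, written as a density. *)
Definition mixed_norm (P : probability Omega R) (xi : R -> Omega -> R)
    (m p q alpha s : R) : \bar R :=
  (\int[leb]_(delta in `[0%R, 1%R])
     ((\int[leb]_(z in `[(- 1)%R, 1%R])
         ((\int[leb]_(t in `[0%R, 1%R])
             ('E_P[fun w => (`|Vdiff xi t z delta w| `^ m)%R] `^ (p / m)))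
          `^ (q / p)))
      `^ (s / q)
      * (delta `^ nu_exponent q alpha s)%R%:E)) `^ s^-1.

End besov.

(* Main.v *)
Require Import Defs.
From HB Require Import structures.
From mathcomp Require Import all_boot all_order all_algebra.
From mathcomp Require Import all_classical all_reals all_analysis.
From mathcomp Require Import measurable_realfun ring.

(** Fix a trajectory.  The substitution [h = z * delta] in the inner integral of
    the modulus of smoothness gives, for [delta > 0],
      [modulus p q f delta = delta^(1/q) *
         (\int_(-1 <= z <= 1) |f(. + z delta) - f|_p^q dz)^(1/q)],
    and the powers of [delta] collect into the density [delta^gamma] of the
    outer measure.  Hence the Besov norm of a trajectory is the iterated norm
    of [V] in [t] (exponent [p]), then [z] (exponent [q]), then [delta]
    (exponent [s], density [delta^gamma]): this is [besov_norm_traj_norm].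

    It remains to move the [L^m] norm in [w] from the outside of this iterated
    norm to its inside.  Since [p, q, s <= m], each of the three exchanges is
    an instance of Minkowski's integral inequality with exponent [m/p], [m/q]
    or [m/s]: see [minkowski_integral] and its form [minkowski_fiber_norm] for
    mixed norms.  The integral inequality itself follows from Tonelli and
    Hoelder.  Writing [G w = \int F (x, w) dx], one has
      [\int G^r <= \int_x \int_w F G^(r-1) <= (\int_x |F x|_r) (\int G^r)^(1-1/r)],
    and one divides by the last factor.  This is legitimate when [\int G^r] is
    finite, so [G^r] is first truncated at height [n], and monotone convergence
    removes the truncation.

    Finally, finiteness of the [m]-th moment of the Besov norm forces the norm
    to be finite almost surely. *)

Set Implicit Arguments.
Unset Strict Implicit.
Unset Printing Implicit Defensive.
Import Order.TTheory GRing.Theory Num.Theory numFieldNormedType.Exports.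
Local Open Scope classical_set_scope.
Local Open Scope ring_scope.
Local Open Scope ereal_scope.

(** * Powers and integrals of extended nonnegative functions *)

Lemma le_poweR (R : realType) (r : R) (x y : \bar R) :
  (0 <= r)%R -> 0 <= x -> x <= y -> x `^ r <= y `^ r.
Proof.
by move=> r0 x0 xy; apply: gt0_ler_poweR => //;
  rewrite in_itv/= leey andbT//; exact: le_trans xy.
Qed.

Lemma poweRVK (R : realType) (r : R) (x : \bar R) :
  (r != 0)%R -> 0 <= x -> (x `^ r^-1) `^ r = x.
Proof. by move=> r0 x0; rewrite -poweRrM mulVf// poweRe1. Qed.

Lemma poweRKV (R : realType) (r : R) (x : \bar R) :
  (r != 0)%R -> 0 <= x -> (x `^ r) `^ r^-1 = x.
Proof. by move=> r0 x0; rewrite -poweRrM mulfV// poweRe1. Qed.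

Lemma measurable_fun_poweR d (T : measurableType d) (R : realType)
    (D : set T) (f : T -> \bar R) (r : R) :
  measurable_fun D f -> measurable_fun D (fun x => f x `^ r).
Proof.
by move=> mf; exact: measurableT_comp (measurable_poweR r) mf.
Qed.

(** The integral of a nonnegative function is a supremum over the simple
    functions below it, which gives monotonicity for arbitrary functions.  It
    serves to compare iterated integrals, whose integrands are themselves
    integrals. *)
Lemma ge0_le_integral_nomeas d (T : measurableType d) (R : realType)
    (mu : {measure set T -> \bar R}) (D : set T) (f g : T -> \bar R) :
  (forall x, D x -> 0 <= f x) -> (forall x, D x -> f x <= g x) ->
  \int[mu]_(x in D) f x <= \int[mu]_(x in D) g x.
Proof.
move=> f0 fg.
have g0 x : D x -> 0 <= g x by move=> Dx; exact: le_trans (f0 x Dx) (fg x Dx).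
rewrite !ge0_integralE//.
apply: le_ereal_sup; apply: image_subset => h hf x.
by apply: le_trans (hf x) _; exact: lee_restrict.
Qed.

(** Extends Hoelder's inequality to a function [f] with infinite values.  If
    [f] has finite [p]-norm it is finite almost everywhere and may be replaced
    by its real part; otherwise the right-hand side is infinite, because the
    other factor is positive. *)
Lemma ge0_hoelder d (T : measurableType d) (R : realType)
    (mu : {measure set T -> \bar R}) (f : T -> \bar R) (g : T -> R) (p q : R) :
  measurable_fun setT f -> measurable_fun setT g ->
  (forall x, 0 <= f x) -> (forall x, 0 <= g x)%R ->
  (0 < p)%R -> (0 < q)%R -> (p^-1 + q^-1 = 1)%R ->
  0 < \int[mu]_x (g x `^ q)%:E ->
  \int[mu]_x (f x * (g x)%:E) <=
  (\int[mu]_x (f x `^ p)) `^ p^-1 * (\int[mu]_x (g x `^ q)%:E) `^ q^-1.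
Proof.
move=> mf mg f0 g0 p0 q0 pq gq0.
have [foo|foo] := eqVneq (\int[mu]_x (f x `^ p)) +oo.
  rewrite foo poweRyr ?invr_eq0 ?gt_eqF// gt0_mulye ?leey//.
  exact: poweR_gt0.
have mfp : measurable_fun setT (fun x => f x `^ p) by exact: measurable_fun_poweR.
have fpi : mu.-integrable setT (fun x => f x `^ p).
  apply/integrableP; split => //.
  under eq_integral do rewrite gee0_abs ?poweR_ge0//.
  by rewrite ltey.
have faefin : \forall x \ae mu, setT x -> f x = (fine (f x))%:E.
  have := integrable_ae measurableT fpi.
  apply: filterS => x /(_ I) h _; rewrite fineK// ge0_fin_numE//.
  rewrite ltey; apply/eqP => fy; move: h.
  by rewrite fy poweRyr ?gt_eqF.
have mff : measurable_fun setT (fun x => fine (f x)).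
  exact: measurableT_comp (fine_measurable measurableT) mf.
have := @hoelder _ _ _ mu _ _ p q mff mg p0 q0 pq.
rewrite Lnorm1 unlock => h.
apply: le_trans (le_trans h _).
  rewrite (@ae_eq_integral _ _ _ mu setT
    (fun x => `|(EFin \o ((fun x => fine (f x)) \* g)%R) x|)) //.
  - by apply: emeasurable_funM => //; exact/measurable_EFinP.
  - by apply: measurableT_comp => //; apply/measurable_EFinP; exact: measurable_funM.
  - apply: filterS faefin => x h' _; rewrite (h' I)/= ger0_norm ?EFinM//.
    by rewrite mulr_ge0// fine_ge0.
rewrite lee_pmul ?poweR_ge0//.
  apply: le_poweR; first by rewrite invr_ge0 ltW.
    by apply: integral_ge0 => x _; exact: poweR_ge0.
  rewrite [leRHS](@ae_eq_integral _ _ _ mu setT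
    (fun x => `|(EFin \o (fun x => fine (f x))) x| `^ p)) //.
  - apply: measurable_fun_poweR; apply: measurableT_comp => //.
    exact/measurable_EFinP.
  - apply: filterS faefin => x h' _; rewrite (h' I)/= ger0_norm//.
    by rewrite fine_ge0.
apply: le_poweR; first by rewrite invr_ge0 ltW.
  by apply: integral_ge0 => x _; exact: poweR_ge0.
by under eq_integral do rewrite /= ger0_norm//.
Qed.

Lemma cvg_mine_natr (R : realType) (x : \bar R) : -oo < x ->
  mine x n%:R%:E @[n --> \oo] --> x.
Proof.
case: x => [r _| _|//].
  apply: cvg_near_cst; near=> n; apply/eqP; rewrite eq_sym minEle ifT//.
  rewrite lee_fin; near: n; exact: nbhs_infty_ger.
under eq_fun do rewrite min_r ?leey//.
exact/cvgenyP.
Unshelve. all: by end_near. Qed.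
(** * Minkowski's integral inequality *)

Lemma minkowski_integral_setT d1 d2 (T1 : measurableType d1)
    (T2 : measurableType d2) (R : realType)
    (mu : {sigma_finite_measure set T1 -> \bar R})
    (P : {finite_measure set T2 -> \bar R}) (F : T1 * T2 -> \bar R) (r : R) :
  measurable_fun setT F -> (forall x, 0 <= F x) -> (1 <= r)%R ->
  (\int[P]_w ((\int[mu]_x F (x, w)) `^ r)) `^ r^-1 <=
  \int[mu]_x ((\int[P]_w (F (x, w) `^ r)) `^ r^-1).
Proof.
move=> mF F0; rewrite le_eqVlt => /predU1P[<-|r1].
  rewrite invr1 poweRe1; last by apply: integral_ge0 => w _; exact: poweR_ge0.
  under eq_integral do rewrite poweRe1 ?integral_ge0//.
  under [leRHS]eq_integral.
    move=> x _; rewrite poweRe1; last by apply: integral_ge0 => w _; exact: poweR_ge0.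
    under eq_integral do rewrite poweRe1//.
    over.
  by rewrite fubini_tonelli.
have r0 : (0 < r)%R by exact: lt_trans r1.
have rn0 : (r != 0)%R by rewrite gt_eqF.
have rV0 : (0 < r^-1)%R by rewrite invr_gt0.
pose G w := \int[mu]_x F (x, w).
pose N x := (\int[P]_w (F (x, w) `^ r)) `^ r^-1.
rewrite -/(\int[mu]_x N x); set M := \int[mu]_x N x.
have G0 w : 0 <= G w by exact: integral_ge0.
have N0 x : 0 <= N x by exact: poweR_ge0.
have M0 : 0 <= M by exact: integral_ge0.
have mG : measurable_fun setT G by exact: measurable_fun_fubini_tonelli_G.
have mN : measurable_fun setT N.
  apply: measurable_fun_poweR.
  apply: (@measurable_fun_fubini_tonelli_F _ _ _ _ _ P (fun z => F z `^ r)).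
    exact: measurable_fun_poweR.
  by move=> x; exact: poweR_ge0.
have mGr : measurable_fun setT (fun w => G w `^ r) by exact: measurable_fun_poweR.
(* The truncations live on [G ^ r], so that their integrals converge to that
   of [G ^ r] without further manipulation of powers. *)
pose Hn n w := mine (G w `^ r) n%:R%:E.
have Hn0 n w : 0 <= Hn n w.
  rewrite /Hn le_min poweR_ge0. by rewrite lee_fin ler0n.
have mHn n : measurable_fun setT (Hn n) by exact: measurable_mine.
suff key n : \int[P]_w Hn n w <= M `^ r.
  rewrite -(poweRKV rn0 M0); apply: le_poweR; first exact: ltW.
    by apply: integral_ge0 => w _; exact: poweR_ge0.
  have -> : \int[P]_w (G w `^ r) = \int[P]_w (limn (fun n => Hn n w)).
    apply: eq_integral => w _; apply/esym/cvg_lim => //.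
    by apply: cvg_mine_natr; exact: lt_le_trans (poweR_ge0 _ _).
  have nd w : setT w -> {homo Hn ^~ w : m n / (m <= n)%N >-> m <= n}.
    by move=> _ m n mn; rewrite /Hn le_min ge_min lexx ge_min lee_fin ler_nat mn orbT.
  have cv := @cvg_monotone_convergence _ _ _ P setT measurableT Hn mHn
    (fun n w _ => Hn0 n w) nd.
  rewrite -(cvg_lim _ cv)//; apply: lime_le; first by apply/cvg_ex; eexists; exact: cv.
  by near=> n; exact: key.
pose H w := fine (Hn n w).
have HE w : (H w)%:E = Hn n w.
  rewrite fineK// ge0_fin_numE//; apply: le_lt_trans (ltry n%:R).
  by rewrite ge_min lexx orbT.
have H0 w : (0 <= H w)%R by rewrite -lee_fin HE.
have mH : measurable_fun setT H by exact: measurableT_comp (mHn n).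
set X := \int[P]_w Hn n w.
have X0 : 0 <= X by exact: integral_ge0.
have Xfin : X < +oo.
  apply: (@le_lt_trans _ _ (\int[P]_w (cst n%:R%:E w))).
    by apply: ge0_le_integral_nomeas => // w _; rewrite ge_min lexx orbT.
  rewrite integral_cst//; apply: lte_mul_pinfty => //.
  by rewrite -ge0_fin_numE//; exact: fin_num_measure.
have [->|Xn0] := eqVneq X 0; first exact: poweR_ge0.
have Xgt0 : 0 < X by rewrite lt0e Xn0.
(* [th] is the inverse of the exponent conjugate to [r]. *)
pose th := (1 - r^-1)%R.
have th0 : (0 < th)%R by rewrite subr_gt0 invf_lt1.
pose g w := (H w `^ th)%R.
have gq w : (g w `^ th^-1)%R = H w.
  by rewrite /g -powRrM mulfV ?gt_eqF// powRr1.
have Xth : 0 < X `^ th by exact: poweR_gt0.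
have Xthfin : X `^ th \is a fin_num by rewrite fin_num_poweR// ge0_fin_numE.
(* Since [G >= H ^ (1/r)], [H = H ^ (1/r) * H ^ th <= G * g]; Tonelli and
   Hoelder in [w] then bound the integral of [G * g]. *)
have Xle : X <= M * X `^ th.
  apply: (@le_trans _ _ (\int[P]_w (G w * (g w)%:E))).
    apply: ge0_le_integral_nomeas => // w _.
    have -> : Hn n w = (H w `^ r^-1)%:E * (g w)%:E.
      have thE : (r^-1 + th = 1)%R by rewrite /th addrC subrK.
      by rewrite -HE -EFinM -powRD thE ?powRr1// oner_eq0.
    apply: lee_wpmul2r; first by rewrite lee_fin powR_ge0.
    rewrite -poweR_EFin HE -[leRHS](poweRKV rn0)//.
    by apply: le_poweR => //; [exact: ltW|rewrite ge_min lexx].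
  have mg : measurable_fun setT g.
    exact: measurableT_comp (measurable_powR _) mH.
  have -> : \int[P]_w (G w * (g w)%:E) = \int[P]_w \int[mu]_x (F (x, w) * (g w)%:E).
    apply: eq_integral => w _; rewrite ge0_integralZr//.
      exact: measurableT_comp mF (measurable_pair2 w).
    by rewrite lee_fin powR_ge0.
  rewrite -(@fubini_tonelli _ _ _ _ _ mu P (fun z => F z * (g z.2)%:E)); last 2 first.
    apply: emeasurable_funM => //; apply/measurable_EFinP.
    exact: measurableT_comp mg measurable_snd.
    by move=> z; rewrite mule_ge0// lee_fin powR_ge0.
  rewrite /M -ge0_integralZr//; last exact: ltW.
  apply: ge0_le_integral_nomeas => x _.
    by apply: integral_ge0 => w _; rewrite mule_ge0// lee_fin powR_ge0.
  have XE : X = \int[P]_w (g w `^ th^-1)%:E.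
    by apply: eq_integral => w _; rewrite gq HE.
  have -> : X `^ th = (\int[P]_w (g w `^ th^-1)%:E) `^ th^-1^-1 by rewrite -XE invrK.
  apply: ge0_hoelder => //=.
  - exact: measurableT_comp mF (measurable_pair1 x).
  - by move=> w; exact: powR_ge0.
  - by rewrite invr_gt0.
  - by rewrite invrK /th addrC subrK.
  - by rewrite -XE.
rewrite -(poweRVK rn0 X0); apply: le_poweR; [exact: ltW|exact: poweR_ge0|].
rewrite -(lee_pmul2r Xthfin Xth); apply: le_trans Xle.
by rewrite -poweRD ?add_neq0_poweRD_def// /th addrC subrK ?oner_eq0// poweRe1.
Unshelve. all: by end_near. Qed.

Lemma measurable_fun_integral_fst d1 d2 (T1 : measurableType d1)
    (T2 : measurableType d2) (R : realType)
    (mu : {sigma_finite_measure set T1 -> \bar R}) (D : set T1)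
    (F : T1 * T2 -> \bar R) :
  measurable D -> measurable_fun setT F -> (forall x, 0 <= F x) ->
  measurable_fun setT (fun y => \int[mu]_(x in D) F (x, y)).
Proof.
move=> mD mF F0.
have mDT : measurable (D `*` setT : set (T1 * T2)) by exact: measurableX.
have -> : (fun y => \int[mu]_(x in D) F (x, y)) =
          fubini_G mu (F \_ (D `*` setT)).
  apply/funext => y; rewrite integral_mkcond; apply: eq_integral => x _.
  by rewrite !patchE in_setX in_setT andbT.
apply: measurable_fun_fubini_tonelli_G; last by move=> x; exact: erestrict_ge0.
by apply/(measurable_restrictT _ mDT); exact: measurable_funTS.
Qed.

Lemma minkowski_integral d1 d2 (T1 : measurableType d1)
    (T2 : measurableType d2) (R : realType)
    (mu : {sigma_finite_measure set T1 -> \bar R})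
    (P : {finite_measure set T2 -> \bar R}) (D : set T1)
    (F : T1 * T2 -> \bar R) (r : R) :
  measurable D -> measurable_fun setT F -> (forall x, 0 <= F x) -> (1 <= r)%R ->
  (\int[P]_w ((\int[mu]_(x in D) F (x, w)) `^ r)) `^ r^-1 <=
  \int[mu]_(x in D) ((\int[P]_w (F (x, w) `^ r)) `^ r^-1).
Proof.
move=> mD mF F0 r1.
have rn0 : (r != 0)%R by rewrite gt_eqF// (lt_le_trans _ r1).
have mDT : measurable (D `*` setT : set (T1 * T2)) by exact: measurableX.
have mFD : measurable_fun setT (F \_ (D `*` setT)).
  by apply/(measurable_restrictT _ mDT); exact: measurable_funTS.
have := @minkowski_integral_setT _ _ _ _ _ mu P _ r mFD
  (fun x => erestrict_ge0 (fun t _ => F0 t) x) r1.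
congr (_ `^ _ <= _).
  apply: eq_integral => w _; rewrite [in RHS]integral_mkcond; congr (_ `^ _).
  by apply: eq_integral => x _; rewrite !patchE in_setX in_setT andbT.
rewrite [RHS]integral_mkcond; apply: eq_integral => x _; rewrite patchE.
under eq_integral do rewrite patchE in_setX in_setT andbT.
case: ifPn => // _.
under eq_integral do rewrite poweR0r//.
by rewrite integral0 poweR0r// invr_eq0.
Qed.

Definition fiber_norm d1 d2 (T1 : measurableType d1) (T2 : measurableType d2)
    (R : realType) (mu : {measure set T1 -> \bar R}) (D : set T1) (p : R)
    (F : T1 * T2 -> \bar R) (y : T2) : \bar R :=
  (\int[mu]_(x in D) (F (x, y) `^ p)) `^ p^-1.

Lemma fiber_norm_ge0 d1 d2 (T1 : measurableType d1) (T2 : measurableType d2)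
    (R : realType) (mu : {measure set T1 -> \bar R}) (D : set T1) (p : R)
    (F : T1 * T2 -> \bar R) (y : T2) :
  0 <= fiber_norm mu D p F y.
Proof. exact: poweR_ge0. Qed.

Lemma measurable_fiber_norm d1 d2 (T1 : measurableType d1)
    (T2 : measurableType d2) (R : realType)
    (mu : {sigma_finite_measure set T1 -> \bar R}) (D : set T1) (p : R)
    (F : T1 * T2 -> \bar R) :
  measurable D -> measurable_fun setT F ->
  measurable_fun setT (fiber_norm mu D p F).
Proof.
move=> mD mF; apply: measurable_fun_poweR.
apply: (@measurable_fun_integral_fst _ _ _ _ _ _ _ (fun x => F x `^ p)) => //.
  exact: measurable_fun_poweR.
by move=> x; exact: poweR_ge0.
Qed.

(** The [L^m] norm of a partial [L^p] norm is at most the [L^p] norm of the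
    partial [L^m] norms when [p <= m]: this is Minkowski's integral inequality
    for [F ^ p] with exponent [m / p], raised to the power [1 / p]. *)
Lemma minkowski_fiber_norm d1 d2 (T1 : measurableType d1)
    (T2 : measurableType d2) (R : realType)
    (mu : {sigma_finite_measure set T1 -> \bar R})
    (P : {finite_measure set T2 -> \bar R}) (D : set T1)
    (F : T1 * T2 -> \bar R) (p m : R) :
  measurable D -> measurable_fun setT F -> (forall x, 0 <= F x) ->
  (0 < p)%R -> (p <= m)%R ->
  (\int[P]_w (fiber_norm mu D p F w `^ m)) `^ m^-1 <=
  (\int[mu]_(x in D) ((\int[P]_w (F (x, w) `^ m)) `^ (p / m))) `^ p^-1.
Proof.
move=> mD mF F0 p0 pm.
have pn0 : (p != 0)%R by rewrite gt_eqF.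
have mn0 : (m != 0)%R by rewrite gt_eqF// (lt_le_trans p0).
have r1 : (1 <= m / p)%R by rewrite ler_pdivlMr// mul1r.
have := @minkowski_integral _ _ _ _ _ mu P D (fun z => F z `^ p) _ mD
  (measurable_fun_poweR p mF) (fun z => poweR_ge0 _ _) r1.
have -> : (fun w => (\int[mu]_(x in D) (F (x, w) `^ p)) `^ (m / p)) =
          (fun w => fiber_norm mu D p F w `^ m).
  by apply/funext => w; rewrite /fiber_norm -poweRrM (mulrC m).
have -> : (fun x => (\int[P]_w ((F (x, w) `^ p) `^ (m / p))) `^ (m / p)^-1) =
          (fun x => (\int[P]_w (F (x, w) `^ m)) `^ (p / m)).
  apply/funext => x; rewrite invf_div; congr (_ `^ _).
  by apply: eq_integral => w _; rewrite -poweRrM mulrCA mulfV// mulr1.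
rewrite invf_div mulrC poweRrM => h.
rewrite -[leLHS](poweRKV pn0) ?poweR_ge0//.
by apply: le_poweR; [rewrite invr_ge0 ltW|exact: poweR_ge0|].
Qed.

(** * Rescaling of the Lebesgue measure *)

Lemma lebesgue_measure_scale (R : realType) (c : R) (A : set R) :
  (0 < c)%R -> measurable A ->
  c%:E * pushforward lebesgue_measure
    (fun z : measurableTypeR R => (z * c)%R : measurableTypeR R) A = lebesgue_measure A.
Proof.
move=> c0 mA.
have mphi : measurable_fun setT (fun z : measurableTypeR R => (z * c)%R : measurableTypeR R).
  exact: measurable_funM.
pose k : {nonneg R} := NngNum (ltW c0).
apply/esym/(@lebesgue_measure_unique _
  (mscale k (pushforward lebesgue_measure _))) => //= _ [[a b]] _ <-.
rewrite /mscale/= [X in _ * X](_ : _ =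
    lebesgue_measure (`](a / c)%R, (b / c)%R] : set R)); last first.
  congr lebesgue_measure; apply/seteqP.
  by split => z /=; rewrite !in_itv/= ltr_pdivrMr// ler_pdivlMr.
rewrite !lebesgue_measure_itv/= !lte_fin ltr_pM2r ?invr_gt0//.
case: ifPn => _; last by rewrite mule0.
by rewrite -!EFinB -EFinM -mulrBl mulrC divfK ?gt_eqF.
Qed.

Lemma integral_scale_itv (R : realType) (c : R) (f : R -> \bar R) :
  (0 < c)%R -> measurable_fun setT f -> (forall x, 0 <= f x) ->
  \int[lebesgue_measure]_(h in `[(- c)%R, c]) f h =
  c%:E * \int[lebesgue_measure]_(z in `[(- 1)%R, 1%R]) f (z * c)%R.
Proof.
move=> c0 mf f0.
have mphi : measurable_fun setT (fun z : measurableTypeR R => (z * c)%R : measurableTypeR R).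
  exact: measurable_funM.
have -> : `[(- 1)%R, 1%R]%classic =
    (fun z : measurableTypeR R => (z * c)%R : measurableTypeR R) @^-1` `[(- c)%R, c].
  have zE (z : R) : ((- c <= z * c <= c) = (- 1 <= z <= 1))%R.
    by rewrite -(ler_pM2r c0 (-1)%R) -(ler_pM2r c0 z 1%R) mulN1r mul1r.
  by apply/seteqP; split => z /=; rewrite !in_itv/= zE.
rewrite -(@ge0_integral_pushforward _ _ _ _ _ _ mphi lebesgue_measure _ f)//; last first.
  exact: measurable_funTS.
pose k : {nonneg R} := NngNum (ltW c0).
rewrite -(@ge0_integral_mscale _ _ _ (pushforward lebesgue_measure _) _ _ k)//; last first.
  exact: measurable_funTS.
apply: eq_measure_integral => A mA _.
exact/esym/(lebesgue_measure_scale c0 mA).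
Qed.

(** * Measurability of the increments *)

Lemma measurable_nested_proj d1 d2 d3 d4 (T1 : measurableType d1)
    (T2 : measurableType d2) (T3 : measurableType d3) (T4 : measurableType d4) :
  [/\ measurable_fun setT (fun x : T1 * (T2 * (T3 * T4)) => x.1),
      measurable_fun setT (fun x : T1 * (T2 * (T3 * T4)) => x.2.1),
      measurable_fun setT (fun x : T1 * (T2 * (T3 * T4)) => x.2.2.1) &
      measurable_fun setT (fun x : T1 * (T2 * (T3 * T4)) => x.2.2.2)].
Proof.
have m2 := @measurable_snd _ _ T1 (T2 * (T3 * T4))%type.
have m3 := measurableT_comp (@measurable_snd _ _ T2 (T3 * T4)%type) m2.
split.
- exact: measurable_fst.
- exact: measurableT_comp measurable_fst m2.
- exact: measurableT_comp measurable_fst m3.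
- exact: measurableT_comp measurable_snd m3.
Qed.

(** The variables are nested in the order in which the trajectory norms
    integrate them, so that each partial norm over the first component removes
    one of them and leaves a function of the remaining ones and of [w]. *)
Definition abs_Vdiff (R : realType) d (Omega : measurableType d)
    (xi : R -> Omega -> R)
    (x : measurableTypeR R *
         (measurableTypeR R * (measurableTypeR R * Omega))) : \bar R :=
  (`|Vdiff xi x.1 x.2.1 x.2.2.1 x.2.2.2|)%:E.

(** The increment is a difference of compositions of the process, extended by
    zero to the whole line, with the measurable maps [(t + z * delta, w)] and
    [(t, w)]. *)
Lemma measurable_abs_Vdiff (R : realType) d (Omega : measurableType d)
    (xi : R -> Omega -> R) :
  bimeasurable xi -> measurable_fun setT (abs_Vdiff xi).
Proof.
move=> mxi.
pose X : measurableTypeR R * Omega -> R :=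
  (fun x => xi x.1 x.2) \_ (`[0%R, 1%R] `*` setT).
have mX : measurable_fun setT X.
  have mD : measurable (`[0%R, 1%R] `*` setT : set (measurableTypeR R * Omega)).
    exact: measurableX.
  exact/(measurable_restrictT _ mD).
have XE t w : zero_ext (xi ^~ w) t = X (t, w).
  by rewrite /zero_ext /X !patchE in_setX in_setT andbT.
have [mt mz md mw] := measurable_nested_proj (measurableTypeR R)
  (measurableTypeR R) (measurableTypeR R) Omega.
have mtz := measurable_funD mt (measurable_funM mz md).
have m1 := measurableT_comp mX (measurable_fun_pair mtz mw).
have m2 := measurableT_comp mX (measurable_fun_pair mt mw).
have m3 := measurable_funB m1 m2.
apply/measurable_EFinP; apply: measurableT_comp => //.
rewrite /Vdiff; under eq_fun do rewrite !XE.
exact: m3.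
Qed.

(** * The Besov norm of a trajectory as an iterated norm *)

Lemma powR_nu_exponent (R : realType) (x q alpha s : R) : (0 < x)%R ->
  ((x `^ (- alpha) * x `^ q^-1) `^ s / x = x `^ nu_exponent q alpha s)%R.
Proof.
move=> x0; have xn (a b : R) : (a + b == 0)%R ==> (x != 0)%R by rewrite (gt_eqF x0) implybT.
rewrite -[(x^-1)%R]powR_inv1 ?ltW// -(powRD (xn _ _)) -powRrM -(powRD (xn _ _)) /nu_exponent.
by congr (_ `^ _)%R; ring.
Qed.

Definition traj_t (R : realType) d (Omega : measurableType d)
    (xi : R -> Omega -> R) (p : R) :=
  fiber_norm (@lebesgue_measure R) `[0%R, 1%R] p (abs_Vdiff xi).

Definition traj_tz (R : realType) d (Omega : measurableType d)
    (xi : R -> Omega -> R) (p q : R) :=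
  fiber_norm (@lebesgue_measure R) `[(- 1)%R, 1%R] q (traj_t xi p).

(** The density of the outer measure is put inside the norm, as the [s]-th root
    of [delta ^ gamma], so that the outer norm is again a [fiber_norm] for the
    Lebesgue measure. *)
Definition weighted_traj (R : realType) d (Omega : measurableType d)
    (xi : R -> Omega -> R) (p q s alpha : R)
    (y : measurableTypeR R * Omega) : \bar R :=
  traj_tz xi p q y * ((y.1 `^ nu_exponent q alpha s)%R%:E) `^ s^-1.

Definition traj_norm (R : realType) d (Omega : measurableType d)
    (xi : R -> Omega -> R) (p q s alpha : R) :=
  fiber_norm (@lebesgue_measure R) `[0%R, 1%R] s (weighted_traj xi p q s alpha).

Lemma measurable_traj_t (R : realType) d (Omega : measurableType d)
    (xi : R -> Omega -> R) (p : R) :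
  bimeasurable xi -> measurable_fun setT (traj_t xi p).
Proof.
move=> mxi; apply: measurable_fiber_norm; first exact: measurable_itv.
exact: measurable_abs_Vdiff.
Qed.

Lemma measurable_traj_tz (R : realType) d (Omega : measurableType d)
    (xi : R -> Omega -> R) (p q : R) :
  bimeasurable xi -> measurable_fun setT (traj_tz xi p q).
Proof.
move=> mxi; apply: measurable_fiber_norm; first exact: measurable_itv.
exact: measurable_traj_t.
Qed.

Lemma measurable_weighted_traj (R : realType) d (Omega : measurableType d)
    (xi : R -> Omega -> R) (p q s alpha : R) :
  bimeasurable xi -> measurable_fun setT (weighted_traj xi p q s alpha).
Proof.
move=> mxi; apply: emeasurable_funM; first exact: measurable_traj_tz.
apply: measurable_fun_poweR; apply/measurable_EFinP.
exact: measurableT_comp (measurable_powR _) measurable_fst.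
Qed.

Lemma weighted_traj_ge0 (R : realType) d (Omega : measurableType d)
    (xi : R -> Omega -> R) (p q s alpha : R) y :
  0 <= weighted_traj xi p q s alpha y.
Proof. by rewrite mule_ge0 ?poweR_ge0 ?fiber_norm_ge0. Qed.

(** The increment depends on [z] and [delta] only through [z * delta]; taking
    [delta = 1] recovers the increment of step [h] of the modulus of
    smoothness. *)
Lemma traj_t_scale (R : realType) d (Omega : measurableType d)
    (xi : R -> Omega -> R) (p z delta : R) (w : Omega) :
  traj_t xi p ((z * delta)%R, (1%R, w)) = traj_t xi p (z, (delta, w)).
Proof. by rewrite /traj_t /fiber_norm /abs_Vdiff /Vdiff/= mulr1. Qed.

Lemma LpT_norm_shift_diff (R : realType) d (Omega : measurableType d)
    (xi : R -> Omega -> R) (p h : R) (w : Omega) :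
  LpT_norm p (shift_diff (xi ^~ w) h) = traj_t xi p (h, (1%R, w)).
Proof.
rewrite /LpT_norm /traj_t /fiber_norm; congr (_ `^ _).
by apply: eq_integral => t _; rewrite poweR_EFin /Vdiff/= mulr1.
Qed.

Lemma modulus_traj_tz (R : realType) d (Omega : measurableType d)
    (xi : R -> Omega -> R) (p q delta : R) (w : Omega) :
  bimeasurable xi -> (0 < delta)%R ->
  modulus p q (xi ^~ w) delta =
  (delta `^ q^-1)%R%:E * traj_tz xi p q (delta, w).
Proof.
move=> mxi d0; rewrite /modulus.
under eq_integral do rewrite LpT_norm_shift_diff.
have mf : measurable_fun setT
    (fun h : measurableTypeR R => traj_t xi p (h, (1%R : measurableTypeR R, w)) `^ q).
  apply: measurable_fun_poweR.
  exact: measurableT_comp (measurable_traj_t p mxi) (measurable_pair2 _).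
rewrite (integral_scale_itv d0 mf); last by move=> h; exact: poweR_ge0.
under eq_integral do rewrite traj_t_scale.
have I0 : 0 <= \int[lebesgue_measure]_(z in `[(- 1)%R, 1%R])
    (traj_t xi p (z, (delta, w)) `^ q).
  by apply: integral_ge0 => z _; exact: poweR_ge0.
by rewrite poweRM// ?lee_fin ?(ltW d0)// poweR_EFin.
Qed.

(** Both outer integrands agree at every [delta].  At [delta = 0] both vanish:
    the first because the inverse of zero is zero, the second because the
    increments of step zero are zero. *)
Lemma besov_norm_traj_norm (R : realType) d (Omega : measurableType d)
    (xi : R -> Omega -> R) (p q s alpha : R) (w : Omega) :
  bimeasurable xi -> (0 < p)%R -> (0 < q)%R -> (0 < s)%R ->
  besov_norm p q alpha s (xi ^~ w) = traj_norm xi p q s alpha w.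
Proof.
move=> mxi p0 q0 s0; rewrite /besov_norm /traj_norm /fiber_norm; congr (_ `^ _).
apply: eq_integral => /= delta; rewrite inE/= in_itv/= => /andP[d0 _].
rewrite /weighted_traj/=; move: d0; rewrite le_eqVlt => /predU1P[<-|d0].
  rewrite invr0 mule0 poweRM ?poweR_ge0 ?fiber_norm_ge0//.
  have -> : traj_tz xi p q (0%R, w) = 0.
    rewrite /traj_tz /fiber_norm; under eq_integral => z _.
      rewrite /traj_t /fiber_norm; under eq_integral => t _.
        rewrite /abs_Vdiff/= /Vdiff mulr0 addr0 subrr normr0 powR0 ?gt_eqF//.
        over.
      rewrite integral0 !poweR0r ?invr_eq0 ?gt_eqF//.
      over.
    by rewrite integral0 poweR0r ?invr_eq0 ?gt_eqF.
  by rewrite poweR0r ?gt_eqF// mul0e.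
have T0 := fiber_norm_ge0 (@lebesgue_measure R) `[(- 1)%R, 1%R] q (traj_t xi p) (delta, w).
rewrite modulus_traj_tz// muleA -EFinM.
have k0 : 0 <= (delta `^ (- alpha) * delta `^ q^-1)%:E.
  by rewrite lee_fin mulr_ge0 ?powR_ge0.
have w0 : 0 <= ((delta `^ nu_exponent q alpha s) `^ s^-1)%:E.
  by rewrite lee_fin powR_ge0.
rewrite (poweRM _ k0 T0) (poweRM _ T0 w0) !poweR_EFin.
rewrite -(powRrM _ s^-1) mulVf ?gt_eqF// powRr1 ?powR_ge0//.
rewrite [RHS]muleC -muleA (muleC (traj_tz _ _ _ _ `^ _)) muleA; congr (_ * _).
by rewrite -EFinM powR_nu_exponent.
Qed.

(** * Moments of the Besov norm *)

Lemma bimeasurable_section (R : realType) d (Omega : measurableType d)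
    (xi : R -> Omega -> R) (w : Omega) :
  bimeasurable xi -> measurable_fun (`[0%R, 1%R] : set R) (xi ^~ w).
Proof.
move=> mxi; have mD : measurable (`[0%R, 1%R] : set (measurableTypeR R)).
  exact: measurable_itv.
have mDX : measurable (`[0%R, 1%R] `*` setT : set (measurableTypeR R * Omega)).
  exact: measurableX.
have /(measurable_restrictT _ mDX) mX := mxi.
have := measurableT_comp mX (@measurable_pair2 _ _ (measurableTypeR R) Omega w).
move=> mXw; apply/(measurable_restrictT _ mD).
congr (measurable_fun _ _): mXw; apply/funext => t /=.
by rewrite !patchE in_setX in_setT andbT.
Qed.

(** At a fixed [delta] the weight is a constant, which leaves the integral in
    [w] as the factor [delta ^ gamma]; Minkowski's inequality is then applied
    to the norm in [z], and for each [z] to the norm in [t]. *)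
Lemma le_weighted_traj (R : realType) d (Omega : measurableType d)
    (P : probability Omega R) (xi : R -> Omega -> R)
    (p q s alpha m : R) (delta : measurableTypeR R) :
  bimeasurable xi -> (0 < p)%R -> (0 < q)%R -> (0 < s)%R ->
  (p <= m)%R -> (q <= m)%R ->
  (\int[P]_w (weighted_traj xi p q s alpha (delta, w) `^ m)) `^ (s / m) <=
  (\int[lebesgue_measure]_(z in `[(- 1)%R, 1%R])
     ((\int[lebesgue_measure]_(t in `[0%R, 1%R])
         ('E_P[fun w => (`|Vdiff xi t z delta w| `^ m)%R] `^ (p / m)))
      `^ (q / p))) `^ (s / q) * (delta `^ nu_exponent q alpha s)%R%:E.
Proof.
move=> mxi p0 q0 s0 pm qm.
have m0 : (0 < m)%R by exact: lt_le_trans pm.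
have mT := measurable_traj_t p mxi.
have mTz := measurable_traj_tz p q mxi.
set k := (delta `^ nu_exponent q alpha s)%R%:E.
have k0 : 0 <= k by rewrite lee_fin powR_ge0.
have WE w : weighted_traj xi p q s alpha (delta, w) =
  traj_tz xi p q (delta, w) * k `^ s^-1 by [].
have -> : \int[P]_w (weighted_traj xi p q s alpha (delta, w) `^ m) =
    \int[P]_w (traj_tz xi p q (delta, w) `^ m) * k `^ (m / s).
  rewrite -ge0_integralZr//; last 3 first.
    apply: measurable_fun_poweR; exact: measurableT_comp mTz (measurable_pair1 _).
    by move=> w _; exact: poweR_ge0.
    exact: poweR_ge0.
  apply: eq_integral => w _; rewrite WE (poweRM _ (fiber_norm_ge0 _ _ _ _ _) (poweR_ge0 _ _)).
  by rewrite -poweRrM mulrC.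
have I0 : 0 <= \int[P]_w (traj_tz xi p q (delta, w) `^ m).
  by apply: integral_ge0 => w _; exact: poweR_ge0.
rewrite (poweRM _ I0 (poweR_ge0 _ _)) -(poweRrM k) mulrA divfK ?gt_eqF// mulfV ?gt_eqF// poweRe1//.
apply: lee_wpmul2r => //.
rewrite [(s / m)%R]mulrC [(s / q)%R]mulrC !poweRrM.
apply: le_poweR; [exact: ltW|exact: poweR_ge0|].
have := @minkowski_fiber_norm _ _ _ _ _ (@lebesgue_measure R) P `[(- 1)%R, 1%R]
  (fun zw => traj_t xi p (zw.1, (delta, zw.2))) q m.
move=> /(_ (measurable_itv _)) h.
apply: (le_trans (h _ _ q0 qm)) => {h}.
- apply: measurableT_comp mT _.
  apply: measurable_fun_pair; first exact: measurable_fst.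
  exact: measurableT_comp (measurable_pair1 _) measurable_snd.
- by move=> zw; exact: fiber_norm_ge0.
apply: le_poweR; first by rewrite invr_ge0 ltW.
  by apply: integral_ge0 => z _; exact: poweR_ge0.
apply: ge0_le_integral_nomeas => z _ /=; first exact: poweR_ge0.
rewrite [(q / m)%R]mulrC [(q / p)%R]mulrC !poweRrM.
apply: le_poweR; [exact: ltW|exact: poweR_ge0|].
have := @minkowski_fiber_norm _ _ _ _ _ (@lebesgue_measure R) P `[0%R, 1%R]
  (fun tw => abs_Vdiff xi (tw.1, (z, (delta, tw.2)))) p m.
move=> /(_ (measurable_itv _)) h.
apply: (le_trans (h _ _ p0 pm)) => {h}.
- apply: measurableT_comp (measurable_abs_Vdiff mxi) _.
  apply: measurable_fun_pair; first exact: measurable_fst.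
  apply: measurableT_comp (measurable_pair1 _) _.
  exact: measurableT_comp (measurable_pair1 _) measurable_snd.
- by move=> tw; rewrite lee_fin.
by rewrite unlock.
Qed.

Lemma Lnorm_besov_norm_le (R : realType) d (Omega : measurableType d)
    (P : probability Omega R) (xi : R -> Omega -> R) (p q s alpha m : R) :
  bimeasurable xi -> (0 < p)%R -> (0 < q)%R -> (0 < s)%R ->
  (p <= m)%R -> (q <= m)%R -> (s <= m)%R ->
  'N[P]_(m%:E)[ (fun w => besov_norm p q alpha s (xi ^~ w)) ]
    <= mixed_norm P xi m p q alpha s.
Proof.
move=> mxi p0 q0 s0 pm qm sm; rewrite unlock.
under eq_integral do rewrite besov_norm_traj_norm// gee0_abs ?fiber_norm_ge0//.
have h := @minkowski_fiber_norm _ _ _ _ _ (@lebesgue_measure R) P `[0%R, 1%R]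
  (weighted_traj xi p q s alpha) s m (measurable_itv _)
  (measurable_weighted_traj p q s alpha mxi) (weighted_traj_ge0 xi p q s alpha) s0 sm.
apply: (le_trans h); apply: le_poweR; first by rewrite invr_ge0 ltW.
  by apply: integral_ge0 => z _; exact: poweR_ge0.
apply: ge0_le_integral_nomeas => delta _; first exact: poweR_ge0.
exact: le_weighted_traj.
Qed.

Theorem theorem2p1 (R : realType) (d : measure_display)
    (Omega : measurableType d) (P : probability Omega R)
    (xi : R -> Omega -> R) (hxi : bimeasurable xi)
    (p q s alpha m : R)
    (hp : (1 <= p)%R) (hq : (1 <= q)%R) (hs : (1 <= s)%R)
    (hm : (Num.max p (Num.max q s) <= m)%R)
    (hV : mixed_norm P xi m p q alpha s < +oo) :
  [/\ measurable [set w | besov_space p q alpha s (xi ^~ w)],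
      P [set w | besov_space p q alpha s (xi ^~ w)] = 1
    & 'N[P]_(m%:E)[ (fun w => besov_norm p q alpha s (xi ^~ w)) ]
        <= mixed_norm P xi m p q alpha s].
Proof.
have p0 : (0 < p)%R by exact: lt_le_trans hp.
have q0 : (0 < q)%R by exact: lt_le_trans hq.
have s0 : (0 < s)%R by exact: lt_le_trans hs.
move: hm; rewrite !ge_max => /and3P[pm qm sm].
have m0 : (0 < m)%R by exact: lt_le_trans pm.
have hle := @Lnorm_besov_norm_le _ _ _ P xi p q s alpha m hxi p0 q0 s0 pm qm sm.
pose N := traj_norm xi p q s alpha.
have mN : measurable_fun setT N.
  apply: measurable_fiber_norm; first exact: measurable_itv.
  exact: measurable_weighted_traj.
have N0 w : 0 <= N w by exact: fiber_norm_ge0.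
have BE : [set w | besov_space p q alpha s (xi ^~ w)] = [set w | N w < +oo].
  apply/seteqP; split => w /=; rewrite /besov_space/= besov_norm_traj_norm//.
    by case.
  move=> Nw; split => //; exact: bimeasurable_section.
have mB : measurable [set w | N w < +oo].
  rewrite -[X in measurable X]setTI; exact: emeasurable_fun_infty_o.
rewrite BE; split => //.
have : 'N[P]_(m%:E)[ (fun w => besov_norm p q alpha s (xi ^~ w)) ] < +oo.
  exact: le_lt_trans hle hV.
rewrite unlock => /lty_poweRy; rewrite invr_eq0 gt_eqF// => /(_ isT).
under eq_integral do rewrite besov_norm_traj_norm// gee0_abs ?fiber_norm_ge0//.
move=> Nm_lty.
have Nm_int : P.-integrable setT (fun w => N w `^ m).
  apply/integrableP; split; first exact: measurable_fun_poweR.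
  by under eq_integral do rewrite gee0_abs ?poweR_ge0//.
have Nae : {ae P, forall w, N w < +oo}.
  apply: filterS (integrable_ae measurableT Nm_int) => w /(_ I).
  by rewrite ge0_fin_numE ?poweR_ge0// => /lty_poweRy; apply; rewrite gt_eqF.
have mBc : measurable (~` [set w | N w < +oo]) by exact: measurableC.
have PBc : P (~` [set w | N w < +oo]) = 0 by apply/negligibleP => //; exact: Nae.
by rewrite -[X in P X]setCK probability_setC// PBc sube0.
Qed.
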